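(* Put \[G(x,y,z):=\frac{1}{x^2-1}+\frac{1}{y^2-1}+\frac{1}{z^2-1},\qquad F(x,y,z):=x+\frac1x+y+\frac1y+z+\frac1z .\] Then \[4\,G\left(\frac{1+x}{1-x},\frac{1+y}{1-y},\frac{1+z}{1-z}\right)=F(x,y,z)-6 .\]
   Context: Here $x,y,z$ are independent variables, and $F$ and $G$ are regarded as rational functions in $x,y,z$. *)

(* Defs.v *)
From mathcomp Require Import all_boot all_order all_algebra.
From mathcomp Require Import fraction.
From mathcomp.multinomials Require Import mpoly.

Set Implicit Arguments.
Unset Strict Implicit.
Unset Printing Implicit Defensive.

Import GRing.Theory.
Local Open Scope ring_scope.

(* k(x, y, z), the field of rational functions in three independent
   variables over k. *)
Definition ratfun3 (k : fieldType) : fieldType := {fraction {mpoly k[3]}}.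

Definition ratX (k : fieldType) (i : 'I_3) : ratfun3 k :=
  @FracField.tofrac {mpoly k[3]} 'X_i.

(* The formulas make sense in any field; taken at the variables of
   [ratfun3 k] they are the rational functions F and G, and taken at other
   elements of [ratfun3 k] they are the results of substituting those elements
   for the variables.  Inversion is total (0^-1 = 0), so a value is the
   intended one only where the denominators are nonzero. *)
Definition G (K : fieldType) (x y z : K) : K :=
  1 / (x ^+ 2 - 1) + 1 / (y ^+ 2 - 1) + 1 / (z ^+ 2 - 1).

Definition F (K : fieldType) (x y z : K) : K :=
  x + 1 / x + y + 1 / y + z + 1 / z.

(* Main.v *)
(** The identity is the sum over the three variables of
    [4 / (((1 + t) / (1 - t)) ^+ 2 - 1) = (1 - t) ^+ 2 / t = t + 1 / t - 2]. *)
Require Import Defs.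
From mathcomp Require Import all_boot all_order all_algebra.
From mathcomp Require Import fraction ring.
From mathcomp.multinomials Require Import mpoly.

Import GRing.Theory.
Local Open Scope ring_scope.

(** Since (1 + t)^2 - (1 - t)^2 = 4t, each summand of [G] becomes (1 - t)^2 / (4t) once 2, t and 1 -
    t are nonzero ([cayley_sqr_sub1_inv]). The variables of [ratfun3 k] meet these conditions. *)

Lemma cayley_sqr_sub1_inv (K : fieldType) (t : K) :
  (2%:R : K) != 0 -> t != 0 -> 1 - t != 0 ->
  4%:R * (1 / (((1 + t) / (1 - t)) ^+ 2 - 1)) = t + 1 / t - 2%:R.
Proof.
move=> n2 t0 t1.
have -> : ((1 + t) / (1 - t)) ^+ 2 - 1 = 2%:R * 2%:R * t / (1 - t) ^+ 2.
  by field.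
(* [field] also asks for 4 != 0, obtained from 4 = 2 * 2. *)
by field; rewrite t0 t1 -[4%:R]/((2 * 2)%:R) natrM mulf_neq0.
Qed.

(** The polynomial ['X_i] takes the value 1 at (1, 1, 1). *)
Lemma ratX_neq0 (k : fieldType) (i : 'I_3) : ratX k i != 0.
Proof.
rewrite /ratX tofrac_eq0; apply/eqP => /(congr1 (meval (fun=> 1))) /eqP.
by rewrite mevalXU meval0 oner_eq0.
Qed.

(** The polynomial 1 - ['X_i] takes the value 1 at the origin. *)
Lemma one_sub_ratX_neq0 (k : fieldType) (i : 'I_3) : 1 - ratX k i != 0.
Proof.
rewrite /ratX -tofrac1 -tofracB tofrac_eq0; apply/eqP.
move=> /(congr1 (meval (fun=> 0))) /eqP.
by rewrite mevalB mevalXU meval1 meval0 subr0 oner_eq0.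
Qed.

(** Constants embed injectively, so 2 != 0 passes from [k] to [ratfun3 k]. *)
Lemma ratfun3_natr_eq0 (k : fieldType) (n : nat) :
  ((n%:R : ratfun3 k) == 0) = ((n%:R : k) == 0).
Proof.
by rewrite -tofrac1 -tofracMn tofrac_eq0 -mpolyC1 -mpolyCMn mpolyC_eq0.
Qed.

Theorem mainTheorem2 (k : fieldType) (k_char : (2%:R : k) != 0) :
  let x := ratX k (inord 0) in
  let y := ratX k (inord 1) in
  let z := ratX k (inord 2) in
  4%:R * G ((1 + x) / (1 - x)) ((1 + y) / (1 - y)) ((1 + z) / (1 - z))
    = F x y z - 6%:R.
Proof.
move=> x y z.
have n2 : (2%:R : ratfun3 k) != 0 by rewrite ratfun3_natr_eq0.
rewrite /G !mulrDr !cayley_sqr_sub1_inv ?ratX_neq0 ?one_sub_ratX_neq0 //.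
by rewrite /F; ring.
Qed.
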